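(* Let $X$ be a Banach space with the weak-DD2P. Then $\pi(\operatorname{ext}(B_{X^*}))'$ is an infinite set.
   Context: Banach spaces are over $\mathbb{K}=\mathbb{R}$ or $\mathbb{C}$; $B_X$ and $S_X$ denote the closed unit ball and unit sphere of $X$, $X^*$ is the topological dual, and $\operatorname{ext}(C)$ is the set of extreme points of $C$. $X$ has the weak-DD2P if for every non-empty relatively weakly open subset $W$ of $B_X$ there exists $x\in W$ such that $\sup_{y\in V}\|x-y\|=2$ for every relatively weakly open subset $V$ of $B_X$ with $x\in V$. On $S_{X^*}$ consider the equivalence relation $f\sim g$ if and only if $f$ and $g$ are linearly dependent. The quotient $S_{X^*}/\!\sim$ is endowed with the quotient topology induced by the weak$^*$ topology of $S_{X^*}$, and $\pi\colon S_{X^*}\to S_{X^*}/\!\sim$ is the quotient map. For a subset $A$ of a topological space $V$, $A'$ denotes the set of cluster (accumulation) points of $A$ in $V$; here the ambient space is $S_{X^*}/\!\sim$. *)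

(* Defs.v *)
From HB Require Import structures.
From mathcomp Require Import all_boot all_order all_algebra generic_quotient.
From mathcomp Require Import all_classical all_reals all_analysis.
From mathcomp Require Export complex.

Set Implicit Arguments.
Unset Strict Implicit.
Unset Printing Implicit Defensive.

Import Order.TTheory GRing.Theory Num.Theory.
Import numFieldNormedType.Exports.

Local Open Scope classical_set_scope.
Local Open Scope ring_scope.

(* The definitions are generic in a numFieldType K; they are meant for K = R
   and K = R[i] with R : realType.  Norms take values in K; in R[i] the order
   is the partial one (x <= y iff y - x is real and nonnegative), so that
   suprema of nonempty sets of norms are the usual real ones. *)

Section ExtremePoints.
Context {K : numFieldType} {E : lmodType K}.

(* 0 < t < 1 forces t to be real when K = R[i] *)
Definition extreme_points (C : set E) : set E :=
  [set c | C c /\ forall (x y : E) (t : K), C x -> C y -> 0 < t -> t < 1 ->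
    c = t *: x + (1 - t) *: y -> x = c /\ y = c].

Definition linearly_dependent (f g : E) : Prop :=
  exists a b : K, (a != 0 \/ b != 0) /\ a *: f + b *: g = 0.

End ExtremePoints.

Section Dual.
Context {K : numFieldType} (X : normedModType K).

Definition unit_ball : set X := [set x | `|x| <= 1].

Definition dual : set (X -> K^o) :=
  [set f | (linear f : Prop) /\ continuous f].

Definition dual_norm (f : X -> K^o) : K :=
  supremum 0 [set `|f x| | x in unit_ball].

Definition dual_ball : set (X -> K^o) :=
  [set f | dual f /\ dual_norm f <= 1].

Definition dual_sphere : set (X -> K^o) :=
  [set f | dual f /\ dual_norm f = 1].

(* the weak topology is the initial topology for the family of all f in the
   dual, i.e. for the evaluation map below *)
Definition dual_eval (x : X) : {ptws set_type dual -> K^o} :=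
  fun f => set_val f x.

Definition weakly_open (U : set X) : Prop :=
  open (U : set (initial_topology dual_eval)).

Definition relatively_weakly_open (W : set X) : Prop :=
  exists2 U : set X, weakly_open U & W = U `&` unit_ball.

Definition weak_DD2P : Prop :=
  forall W : set X, relatively_weakly_open W -> W !=set0 ->
    exists2 x : X, W x &
      forall V : set X, relatively_weakly_open V -> V x ->
        supremum 0 [set `|x - y| | y in V] = 2.

(* the weak* topology is the topology of pointwise convergence on X, so the
   sphere is seen as a subspace of {ptws X -> K^o} *)
Definition sphere_type : topologicalType :=
  set_type (dual_sphere : set {ptws X -> K^o}).

Definition sphere_val (f : sphere_type) : X -> K^o := set_val f.

Definition sphere_equiv (f g : sphere_type) : bool :=
  `[< linearly_dependent (sphere_val f) (sphere_val g) >].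

Lemma dual_norm0 : dual_norm 0 = 0.
Proof.
rewrite /dual_norm (_ : [set _ | _ in _] = [set 0]) ?supremum1//.
apply/seteqP; split => [_ [x _ <-]|_ ->] /=; first by rewrite normr0.
by exists 0; rewrite /unit_ball /= normr0.
Qed.

Lemma sphere_neq0 (f : sphere_type) : sphere_val f <> 0.
Proof.
move=> f0; have [_] : dual_sphere (sphere_val f) := set_valP f.
rewrite f0 dual_norm0 => /esym/eqP.
by rewrite oner_eq0.
Qed.

Lemma scaler_sphere_eq0 (a : K) (f : sphere_type) :
  a *: sphere_val f = 0 -> a = 0.
Proof.
have [//|a0 af0] := eqVneq a 0; case: (@sphere_neq0 f).
by rewrite -[LHS](scalerK a0) af0 scaler0.
Qed.

Lemma sphere_equiv_refl : reflexive sphere_equiv.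
Proof.
move=> f; apply/asboolP; exists 1, (-1); split; first by left; rewrite oner_eq0.
by rewrite scaleN1r scale1r subrr.
Qed.

Lemma sphere_equiv_sym : symmetric sphere_equiv.
Proof.
move=> f g; apply/asboolP/asboolP => -[a [b [ab e]]]; exists b, a;
  by split; [case: ab; [right|left] | rewrite addrC].
Qed.

Lemma sphere_equiv_trans : transitive sphere_equiv.
Proof.
move=> g f h /asboolP[a [b [ab fg]]] /asboolP[c [d [cd gh]]].
have a0 : a != 0.
  apply/eqP => a0; move: fg ab; rewrite a0 scale0r add0r eqxx.
  by move=> /scaler_sphere_eq0 ->; rewrite eqxx => -[].
apply/asboolP; exists (c * a), (- (b * d)); split.
  left; rewrite mulf_neq0//; apply/eqP => c0; move: gh cd.
  rewrite c0 scale0r add0r eqxx.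
  by move=> /scaler_sphere_eq0 ->; rewrite eqxx => -[].
move/eqP: fg; rewrite addr_eq0 => /eqP fg.
move/eqP: gh; rewrite addr_eq0 => /eqP gh.
rewrite -scalerA fg scalerN scalerA mulrC -scalerA gh scalerN opprK scalerA.
by rewrite scaleNr subrr.
Qed.

Canonical sphere_equiv_rel :=
  EquivRel sphere_equiv sphere_equiv_refl sphere_equiv_sym sphere_equiv_trans.

Definition sphere_quotient : topologicalType :=
  quotient_topology {eq_quot sphere_equiv_rel}%qT.

Definition sphere_pi (f : sphere_type) : sphere_quotient :=
  (\pi_sphere_quotient f)%qT.

Definition pi_ext_dual_ball : set sphere_quotient :=
  sphere_pi @` (sphere_val @^-1` extreme_points dual_ball).

End Dual.

Arguments unit_ball {K} X _.
Arguments dual {K} X _.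
Arguments dual_ball {K} X _.
Arguments dual_sphere {K} X _.
Arguments pi_ext_dual_ball {K} X _.

(* Main.v *)
From HB Require Import structures.
Require Import Defs.
From mathcomp Require Import all_boot all_order all_algebra generic_quotient.
From mathcomp Require Import all_classical all_reals all_analysis.
From mathcomp Require Import ring lra.
Import Order.TTheory GRing.Theory Num.Theory.
Import numFieldNormedType.Exports.

(** Suppose that the set [L] of limit points of the classes of extreme
    functionals is finite. The functionals representing [L] define a weak
    neighbourhood of [0] in the unit ball, on which each of them is smaller
    than [1] in modulus; the weak-DD2P gives a diametral point [x] in it. A
    functional [f] of norm one with [`|f x| = 1] then represents no point of
    [L], because proportional functionals of norm one have the same modulus at
    [x]. So around such an [f] there is a weak* neighbourhood in which all
    extreme functionals are proportional to [f] ([limit_point_separation]).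

    Let [y] be in the unit ball, weakly close to [x], with [`|x - y|] close to
    [2]. Some extreme functional [e] satisfies [`|e (x - y)| = `|x - y|]
    ([exists_extreme_norming]), and then [`|e x|] is close to [1]. By weak*
    compactness of the dual ball ([compact_dual_ball]), for [y] far enough
    along these points, [e] lies in the neighbourhood of some [f] with
    [`|f x| = 1] as above, so [`|e (x - y)| = `|f (x - y)|], which is smaller
    than [1] as [y] is weakly close to [x]: a contradiction
    ([weak_DD2P_infinite]).

    The extreme norming functional is obtained by a variant of the proof of
    the Hahn-Banach theorem by sublinear functions. A sublinear function is the
    support function of the set of linear forms below it; Zorn's lemma, applied
    to the sublinear functions that describe faces of the dual ball on which
    [z] is normed, gives a minimal one, and minimality makes it linear
    ([exists_extreme_dominated]).

    Real and complex scalars are treated together through the structure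
    [scalar_field], which relates real-linear and [K]-linear forms. *)

Set Implicit Arguments.
Unset Strict Implicit.
Unset Printing Implicit Defensive.

Local Open Scope classical_set_scope.
Local Open Scope ring_scope.

(** * Extreme linear forms below a sublinear function *)

(** Linearity is a proposition in [dual]; bundling it gives access to the
    lemmas on morphisms. *)
Definition pack_linear (K : numFieldType) (V W : lmodType K) (f : V -> W)
    (fl : linear f) : {linear V -> W} :=
  HB.pack f (GRing.isLinear.Build K V W _ f fl).

Lemma linear_formN (K : numFieldType) (V : lmodType K) (f : V -> K^o) x :
  (linear f : Prop) -> f (- x) = - f x.
Proof. by move=> fl; exact: (raddfN (pack_linear fl)). Qed.

Section Sublinear.
Context {R : realType} {V : lmodType R}.
Implicit Types (p q : V -> R) (u : V -> R^o) (w x : V).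

Definition sublinear p : Prop :=
  (forall x y, p (x + y) <= p x + p y) /\
  (forall (a : R) x, 0 <= a -> p (a *: x) = a * p x).

Definition dominated p : set (V -> R^o) :=
  [set u : V -> R^o | (linear u : Prop) /\ forall x, (u x : R) <= p x].

Lemma sublinear0 p : sublinear p -> p 0 = 0.
Proof. by move=> [_ /(_ 0 0)]; rewrite scale0r mul0r; exact. Qed.

Lemma sublinear_ge p x : sublinear p -> - p (- x) <= p x.
Proof.
by move=> ps; have := ps.1 x (- x); rewrite subrr (sublinear0 ps); lra.
Qed.

(** A sublinear [q <= p] stands for the set [dominated q] of linear forms
    below it; the condition says that this set is a face of [dominated p]. *)
Definition face q p : Prop :=
  forall u v (t : R), dominated p u -> dominated p v -> 0 < t -> t < 1 ->
    (forall x, t * u x + (1 - t) * v x <= q x) ->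
    dominated q u /\ dominated q v.

(** The support function of the face of [dominated p] on which [u w] takes its
    largest value [p w]. *)
Definition sharpen w p x : R :=
  inf [set p (x + t *: w) - t * p w | t in [set t | 0 <= t]].

Lemma sharpen_lb w p x (t : R) : sublinear p -> 0 <= t ->
  - p (- x) <= p (x + t *: w) - t * p w.
Proof.
move=> ps t0; have := ps.1 (x + t *: w) (- x).
by rewrite addrAC subrr add0r ps.2//; lra.
Qed.

Lemma sharpen_le w p x (t : R) : sublinear p -> 0 <= t ->
  sharpen w p x <= p (x + t *: w) - t * p w.
Proof.
move=> ps t0; apply: ge_inf; last by exists t.
by exists (- p (- x)) => _ [s s0 <-]; exact: sharpen_lb.
Qed.

Lemma le_sharpen w p x (r : R) :
  (forall t, 0 <= t -> r <= p (x + t *: w) - t * p w) -> r <= sharpen w p x.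
Proof.
move=> H; apply: lb_le_inf; first by exists (p (x + 0 *: w) - 0 * p w), 0 => /=.
by move=> _ [t t0 <-]; exact: H.
Qed.

Lemma sharpen_le_id w p x : sublinear p -> sharpen w p x <= p x.
Proof.
move=> ps; have := sharpen_le w x ps (lexx 0).
by rewrite scale0r addr0 mul0r subr0.
Qed.

Lemma sharpenN w p : sublinear p -> sharpen w p (- w) <= - p w.
Proof.
move=> ps; have := sharpen_le w (- w) ps ler01.
by rewrite scale1r addNr sublinear0// mul1r sub0r.
Qed.

Lemma sharpen_sublinear w p : sublinear p -> sublinear (sharpen w p).
Proof.
move=> ps; split=> [x y|a x].
  rewrite -lerBlDr; apply: le_sharpen => t t0; rewrite lerBlDl -lerBlDr.
  apply: le_sharpen => s s0; rewrite lerBlDr.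
  apply: le_trans (sharpen_le w (x + y) ps (addr_ge0 t0 s0)) _.
  have := ps.1 (x + t *: w) (y + s *: w).
  by rewrite addrACA -scalerDl; lra.
have le1 (b : R) z : 0 < b -> sharpen w p (b *: z) <= b * sharpen w p z.
  move=> b0; rewrite mulrC -ler_pdivrMr//; apply: le_sharpen => t t0.
  have := sharpen_le w (b *: z) ps (mulr_ge0 (ltW b0) t0).
  rewrite -scalerA -scalerDr (ps.2 _ _ (ltW b0)).
  by move=> le_b; rewrite ler_pdivrMr// [leRHS]mulrC mulrBr mulrA.
rewrite le_eqVlt => /predU1P[<-|a0].
  rewrite scale0r mul0r; apply/eqP; rewrite eq_le; apply/andP; split.
    by have := sharpen_le_id w 0 ps; rewrite (sublinear0 ps).
  apply: le_sharpen => t t0.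
  by rewrite add0r ps.2// subrr.
apply/eqP; rewrite eq_le le1//=.
have := @le1 a^-1 (a *: x); rewrite invr_gt0 => /(_ a0).
by rewrite scalerA mulVf ?gt_eqF// scale1r mulrC ler_pdivlMr// mulrC.
Qed.

(** A form attaining [p w] satisfies [u x = u (x + t *: w) - t * p w], so that
    it is below [sharpen w p]. *)
Lemma sharpen_dominated w p u : sublinear p -> dominated p u -> u w = p w ->
  dominated (sharpen w p) u.
Proof.
move=> ps [ul up] uw; split=> // x; apply: le_sharpen => t t0.
have := up (x + t *: w); rewrite addrC ul uw addrC /=.
by rewrite /GRing.scale/=; lra.
Qed.

(** The value at [- w] gives the reason: a convex combination of two forms
    which is below [sharpen w p] is at least [p w] at [w], while both forms
    are at most [p w] there, so both attain [p w]. *)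
Lemma sharpen_face w p : sublinear p -> face (sharpen w p) p.
Proof.
move=> ps u v t pu pv t0 t1 uv.
have := le_trans (uv (- w)) (sharpenN w ps).
rewrite (linear_formN w pu.1) (linear_formN w pv.1) => uvw.
have uw := pu.2 w; have vw := pv.2 w.
have t1' : 0 < 1 - t by rewrite subr_gt0.
have a1 : t * u w <= t * p w by rewrite ler_pM2l.
have a2 : (1 - t) * v w <= (1 - t) * p w by rewrite ler_pM2l.
have a3 : p w <= t * u w + (1 - t) * v w by move: uvw; lra.
have eu : t * u w = t * p w by move: a1 a2 a3; lra.
have ev : (1 - t) * v w = (1 - t) * p w by move: a1 a2 a3; lra.
split; apply: sharpen_dominated => //.
  by apply: (mulfI _ eu); rewrite gt_eqF.
by apply: (mulfI _ ev); rewrite gt_eqF.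
Qed.

Lemma face_trans p q r : (forall x, q x <= p x) -> (forall x, r x <= q x) ->
  face q p -> face r q -> face r p.
Proof.
move=> qp rq fq fr u v t pu pv t0 t1 uv.
have [x|qu qv] := fq _ _ _ pu pv t0 t1; first exact: le_trans (uv x) (rq x).
exact: fr qu qv t0 t1 uv.
Qed.

(** Zorn's lemma: the pointwise infimum of a chain of faces is again a face. The
    condition at [- z] passes to smaller functions and forces every dominated
    form to attain [p z]; [sharpen z p] satisfies it. A minimal face cannot be
    made smaller by sharpening it in any direction. *)
Lemma exists_minimal_face p z : sublinear p -> exists q,
  [/\ sublinear q, forall x, q x <= p x, q (- z) <= - p z, face q p &
    forall w x, q x <= sharpen w q x].
Proof.
move=> ps.
pose P q := [/\ sublinear q, forall x, q x <= p x, q (- z) <= - p z & face q p].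
have P0 : P (sharpen z p).
  split; [exact: sharpen_sublinear|by move=> x; exact: sharpen_le_id
    |exact: sharpenN|exact: sharpen_face].
pose T := {q | P q}.
pose le_face (q r : T) := `[< forall x, sval r x <= sval q x >].
have [|||[q Pq] qmin] := @ZL_preorder T (exist _ _ P0) le_face.
- by move=> q; apply/asboolP.
- move=> r q s /asboolP qr /asboolP sq; apply/asboolP => x.
  exact: le_trans (sq x) (qr x).
- move=> A Atot.
  have [[q0 Aq0]|A0] := pselect (A !=set0); last first.
    exists (exist _ _ P0) => s As.
    by case: A0; exists s.
  pose q x := inf [set sval r x | r in A].
  have lbq x : has_lbound [set sval r x | r in A].
    exists (- p (- x)) => _ [[r [rs rp rz rf]] Ar <-] /=.
    by apply: le_trans (sublinear_ge x rs); rewrite lerN2.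
  have q_le r x : A r -> q x <= sval r x.
    by move=> Ar; apply: ge_inf => //; exists r.
  have le_q c x : (forall r, A r -> c <= sval r x) -> c <= q x.
    move=> H; apply: lb_le_inf; first by exists (sval q0 x), q0.
    by move=> _ [r Ar <-]; exact: H.
  have Pq : P q.
    split.
    + split=> [x y|a x a0].
        (* The smaller of the two members of the chain bounds both. *)
        rewrite -lerBlDr; apply: (le_q) => r Ar; rewrite lerBlDl -lerBlDr.
        apply: (le_q) => s As; rewrite lerBlDr.
        have [/asboolP rs|/asboolP sr] := Atot _ _ Ar As.
          apply: le_trans (q_le s _ As) _.
          have := (svalP s).
          case=> -[] /(_ x y) + _ _ _ _; have := rs x; lra.
        apply: le_trans (q_le r _ Ar) _.
        have := (svalP r).
        case=> -[] /(_ x y) + _ _ _ _; have := sr y; lra.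
      move: a0; rewrite le_eqVlt => /predU1P[<-|a0].
        rewrite scale0r mul0r; apply/eqP; rewrite eq_le; apply/andP; split.
          have := q_le _ 0 Aq0; have [rs _ _ _] := svalP q0.
          by rewrite (sublinear0 rs).
        apply: (le_q) => r Ar; have [rs _ _ _] := svalP r.
        by rewrite (sublinear0 rs).
      apply/eqP; rewrite eq_le; apply/andP; split.
        rewrite mulrC -ler_pdivrMr//; apply: (le_q) => r Ar.
        rewrite ler_pdivrMr// mulrC.
        have [[_ rs] _ _ _] := svalP r; rewrite -(rs _ _ (ltW a0)).
        exact: q_le.
      apply: (le_q) => r Ar.
      have [[_ rs] _ _ _] := svalP r.
      by rewrite (rs _ _ (ltW a0)) ler_pM2l//; exact: q_le.
    + move=> x; apply: le_trans (q_le _ _ Aq0) _.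
      by have [_ + _ _] := svalP q0; apply.
    + apply: le_trans (q_le _ _ Aq0) _.
      by have [_ _ + _] := svalP q0.
    + move=> u v t pu pv t0 t1 uv.
      have H r : A r -> dominated (sval r) u /\ dominated (sval r) v.
        move=> Ar; have [_ _ _ rf] := svalP r.
        apply: (rf _ _ _ pu pv t0 t1) => x.
        exact: le_trans (uv x) (q_le _ _ Ar).
      by split; (split; first by [case: pu|case: pv]) => x;
        apply: (le_q) => r /H[[_ +] [_ +]].
  exists (exist _ _ Pq) => s As; apply/asboolP => x /=; exact: q_le.
exists q; have [qs qp qz qf] := Pq; split=> // w.
have Pw : P (sharpen w q).
  split; first exact: sharpen_sublinear.
  - by move=> x; apply: le_trans (qp x); exact: sharpen_le_id.
  - by apply: le_trans qz; exact: sharpen_le_id.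
  - apply: (face_trans qp) => //; first by move=> x; exact: sharpen_le_id.
    exact: sharpen_face.
have := qmin (exist _ _ Pw).
have -> : le_face (exist P q Pq) (exist P (sharpen w q) Pw).
  by apply/asboolP => x; exact: sharpen_le_id.
by move=> /(_ isT)/asboolP.
Qed.

(** Compare the values at [x] and at [- x]. *)
Lemma dominated_linear_eq u v : (linear u : Prop) -> dominated u v -> v = u.
Proof.
move=> ul [vl vu]; apply/funext => x; apply/eqP; rewrite eq_le vu/=.
by have := vu (- x); rewrite !linear_formN// lerN2.
Qed.

(** Being equal to all of its sharpenings, a minimal face [q] satisfies
    [q (- w) = - q w] for every [w]. A sublinear odd function is linear, so
    the face consists of [q] alone and [q] is an extreme point. This gives
    the Hahn-Banach theorem and the extremality at once, with no topology. *)
Theorem exists_extreme_dominated p z : sublinear p ->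
  exists2 u, extreme_points (dominated p) u & u z = p z.
Proof.
move=> ps; have [q [qs qp qz qf qw]] := exists_minimal_face z ps.
have qN w : q (- w) = - q w.
  apply/eqP; rewrite eq_le (le_trans (qw w _) (sharpenN w qs))/=.
  by rewrite lerNl sublinear_ge.
have qD x y : q (x + y) = q x + q y.
  apply/eqP; rewrite eq_le qs.1/=.
  by have := qs.1 (- x) (- y); rewrite -opprD !qN; lra.
have ql : (linear (q : V -> R^o) : Prop).
  move=> a x y; rewrite qD; congr (_ + _).
  have [a0|a0] := leP 0 a; first by rewrite qs.2.
  rewrite -[a *: x]opprK -scaleNr qN qs.2 ?oppr_ge0; last exact: ltW.
  by rewrite mulNr opprK.
exists q; last first.
  by apply/eqP; rewrite eq_le qp/= -lerN2 -qN.
split=> // u v t pu pv t0 t1 quv.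
have [x|qu qv] := qf _ _ _ pu pv t0 t1.
  by rewrite quv.
by split; exact: dominated_linear_eq.
Qed.

End Sublinear.

(** * Scalar fields with a real part *)

(** What the proof uses of the scalars, so that one argument covers the real and
    the complex case. The field [complexify] is the correspondence between
    real-linear and [K]-linear forms, which for complex scalars sends [u] to
    the form with value [u x - i u (i x)] at [x]. *)
Record scalar_field (R : realType) (K : numFieldType) := ScalarField {
  inj : {rmorphism R -> K};
  re : {additive K -> R};
  re_injM : forall a z, re (inj a * z) = a * re z;
  re1 : re 1 = 1;
  inj_le : forall a b, (inj a <= inj b) = (a <= b);
  inj_re : forall z : K, z \is Num.real -> inj (re z) = z;
  inj_re_le : forall z, inj (re z) <= `|z|;
  compact_disc : forall r : K, compact [set z : K^o | `|z| <= r];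
  complexify : forall (V : lmodType K) (u : V -> R),
    (forall x y, u (x + y) = u x + u y) ->
    (forall a x, u (inj a *: x) = a * u x) ->
    exists2 f : V -> K^o, (linear f : Prop) & forall x, re (f x) = u x }.

(** Restriction of scalars; the alias carries the real module structure. *)
Definition realify (R : realType) (K : numFieldType) (S : scalar_field R K)
  (V : lmodType K) : Type := V.

Section Realify.
Context {R : realType} {K : numFieldType} (S : scalar_field R K).
Context (V : lmodType K).

Definition realify_scale (a : R) (x : V) : V := inj S a *: x.

Lemma realify_scalerA a b x :
  realify_scale a (realify_scale b x) = realify_scale (a * b) x.
Proof. by rewrite /realify_scale scalerA rmorphM. Qed.

Lemma realify_scale1r : left_id 1 realify_scale.
Proof. by move=> x; rewrite /realify_scale rmorph1 scale1r. Qed.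

Lemma realify_scalerDr : right_distributive realify_scale +%R.
Proof. by move=> a x y; rewrite /realify_scale scalerDr. Qed.

Lemma realify_scalerDl x : {morph realify_scale^~ x : a b / a + b}.
Proof. by move=> a b; rewrite /realify_scale rmorphD scalerDl. Qed.

HB.instance Definition _ := GRing.Zmodule.on (realify S V).
HB.instance Definition _ := GRing.Zmodule_isLmodule.Build R (realify S V)
  realify_scalerA realify_scale1r realify_scalerDr realify_scalerDl.

End Realify.

Section ScalarFieldTheory.
Context {R : realType} {K : numFieldType} (S : scalar_field R K).

Lemma re_inj a : re S (inj S a) = a.
Proof. by rewrite -[inj S a]mulr1 re_injM re1 mulr1. Qed.

Lemma re_comb a b (z w : K) :
  re S (inj S a * z + inj S b * w) = a * re S z + b * re S w.
Proof. by rewrite raddfD/= !re_injM. Qed.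

Lemma inj_lt a b : (inj S a < inj S b) = (a < b).
Proof. by rewrite !lt_neqAle inj_le (inj_eq (can_inj re_inj)). Qed.

(** Norms take values in [K], whose order may be partial; the supremum is
    computed in the reals and sent back to [K]. *)
Lemma supremums_real (A : set K) (c : K) : A !=set0 ->
  (forall z, A z -> 0 <= z) -> ubound A c -> supremums A !=set0.
Proof.
move=> [a Aa] Ar Ac.
have cr : c \is Num.real.
  by rewrite ger0_real// (le_trans (Ar _ Aa))//; exact: (Ac _ Aa).
have hs : has_sup [set re S z | z in A].
  split; first by exists (re S a), a.
  exists (re S c) => _ [z Az <-].
  rewrite -(inj_le S) (inj_re S cr) (inj_re S (ger0_real (Ar _ Az))).
  exact: Ac.
exists (inj S (sup [set re S z | z in A])); split=> [z Az|d Ad].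
  rewrite -(@inj_re _ _ S z) ?ger0_real ?Ar// inj_le.
  by apply: sup_upper_bound => //; exists z.
have dr : d \is Num.real.
  by rewrite ger0_real// (le_trans (Ar _ Aa))//; exact: (Ad _ Aa).
rewrite -(@inj_re _ _ S d)// inj_le; apply: ge_sup; first by exists (re S a), a.
move=> _ [z Az <-].
rewrite -(inj_le S) (inj_re S dr) (inj_re S (ger0_real (Ar _ Az))).
exact: Ad.
Qed.

Lemma supremum_neq0P (A : set K) (s : K) : supremum 0 A = s -> s != 0 ->
  supremums A s.
Proof.
rewrite /supremum; case: ifP => _ <-; first by rewrite eqxx.
by case: xgetP => [y ->//|_]; rewrite eqxx.
Qed.

(** A nonzero value of the difference can be rotated to its modulus, which is
    its own real part. *)
Lemma linear_re_inj (V : lmodType K) (f g : V -> K^o) :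
  (linear f : Prop) -> (linear g : Prop) ->
  (forall x, re S (f x) = re S (g x)) -> f = g.
Proof.
move=> fl gl fg; apply/funext => x; apply/eqP; rewrite -subr_eq0 -normr_eq0.
pose F := pack_linear fl; pose G := pack_linear gl.
have [->|h0] := eqVneq (f x - g x) 0; first by rewrite normr0.
pose c := `|f x - g x| / (f x - g x).
have e : `|f x - g x| = F (c *: x) - G (c *: x).
  rewrite (linearZ_LR F) (linearZ_LR G) -[RHS]/(c * f x - c * g x).
  by rewrite -mulrBr divfK.
rewrite -(inj_re S (normr_real (f x - g x))) e raddfB /=.
by rewrite [re S (F _)]fg subrr rmorph0.
Qed.

End ScalarFieldTheory.

(** * The dual ball *)

Section DualBall.
Context {R : realType} {K : numFieldType} (S : scalar_field R K).
Context {X : normedModType K}.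
Implicit Types (f g : X -> K^o) (x y z : X).

(** Since [supremum] is [0] on a set without supremum, the forward direction
    needs the existence of the supremum, which comes from continuity. *)
Lemma dual_ballP f : dual_ball X f <->
  (linear f : Prop) /\ (forall x, `|f x| <= `|x|).
Proof.
split=> [[[fl fc] f1]|[fl f1]]; pose F := pack_linear fl.
  split=> // x; have [->|x0] := eqVneq x 0.
    by rewrite [f 0](raddf0 F) !normr0.
  have fZ a y : f (a *: y) = a * f y by exact: (linearZ_LR F).
  have fb : bounded_near F (nbhs (0 : X)).
    by apply: continuous_linear_bounded; exact: fc.
  have [c c0 fcb] := pinfty_ex_gt0 ((linear_boundedP F).1 fb).
  have [s ss] : supremums [set `|f x| | x in unit_ball X] !=set0.
    apply: (@supremums_real _ _ S _ c).
    - by exists (`|f 0|), 0 => //; rewrite /unit_ball /= normr0.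
    - by move=> _ [y _ <-].
    - move=> _ [y y1 <-]; apply: le_trans (fcb y) _.
      by rewrite ler_piMr// ltW.
  have s1 : s <= 1.
    move: f1; rewrite /dual_norm /supremum ifF; last first.
      by apply/eqP => /seteqP[+ _] => /(_ `|f 0|); apply; exists 0 => //;
        rewrite /unit_ball /= normr0.
    case: xgetP => [y -> yy y1|/(_ s)//].
    by rewrite (is_subset1_supremums ss yy).
  have := ss.1 `|f (`|x|^-1 *: x)|; rewrite fZ normrM normfV normr_id.
  rewrite ler_pdivrMl ?normr_gt0// => H; apply: (le_trans (H _)).
    exists (`|x|^-1 *: x); last by rewrite fZ normrM normfV normr_id.
    by rewrite /unit_ball /= normrZ normfV normr_id mulVf// normr_eq0.
  by rewrite ler_piMr.
split; first split=> //.
  apply: (@bounded_linear_continuous _ _ _ F); apply/linear_boundedP.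
  near=> r => x; apply: le_trans (f1 x) _.
  by rewrite ler_peMl//; near: r; apply: nbhs_pinfty_ge; rewrite real1.
rewrite /dual_norm /supremum; case: ifP => // _.
case: xgetP => // s -> [_]; apply.
by move=> _ [x x1 <-]; exact: le_trans (f1 x) x1.
Unshelve. all: by end_near. Qed.

Lemma dual_sphere_attained f x : dual_ball X f -> `|x| <= 1 -> `|f x| = 1 ->
  dual_sphere X f.
Proof.
move=> /[dup] /dual_ballP[_ fx] [fd _] x1 fx1; split=> //.
suff s1 : supremums [set `|f x| | x in unit_ball X] 1.
  rewrite /dual_norm /supremum ifF.
    case: xgetP => [y -> yy|/(_ 1)//].
    exact: (is_subset1_supremums yy s1).
  by apply/eqP => /seteqP[+ _] => /(_ `|f x|); apply; exists x.
split=> [_ [y y1 <-]|c]; first exact: le_trans (fx y) y1.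
by move=> /(_ `|f x|); rewrite fx1; apply; exists x.
Qed.

Lemma dual_sphere_norming f z : dual_ball X f -> 0 < `|z| -> `|f z| = `|z| ->
  dual_sphere X f.
Proof.
move=> fB z0 fz; have /dual_ballP[fl _] := fB.
have nz : `|(`|z|^-1)| = `|z|^-1 by rewrite normfV normr_id.
apply: (@dual_sphere_attained f (`|z|^-1 *: z)) => //.
  by rewrite normrZ nz mulVf ?gt_eqF.
rewrite [f _](linearZ_LR (pack_linear fl)) [X in `|X|]/(`|z|^-1 * f z).
by rewrite normrM nz fz mulVf ?gt_eqF.
Qed.

Lemma dual_sphere_ball f : dual_sphere X f -> dual_ball X f.
Proof. by move=> [fd f1]; split=> //; rewrite f1. Qed.

(** Banach-Alaoglu: the ball is the closed set of linear functions in a product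
    of compact discs. *)
Lemma compact_dual_ball : compact (dual_ball X : set {ptws X -> K^o}).
Proof.
have comp := @tychonoff X (fun=> K^o) (fun x => [set z : K^o | `|z| <= `|x|])
  (fun x => compact_disc S (r := `|x|)).
have ev x : continuous (fun f : {ptws X -> K^o} => f x).
  exact: (@proj_continuous X (fun=> K^o) x).
pose h (t : K * X * X) (f : {ptws X -> K^o}) : K^o :=
  f (t.1.1 *: t.1.2 + t.2) - (t.1.1 *: f t.1.2 + f t.2).
have hc t : continuous (h t).
  move=> f.
  have evZ : (fun g : {ptws X -> K^o} => t.1.1 *: g t.1.2) @ nbhs f -->
      (t.1.1 *: f t.1.2 : K^o).
    by apply: cvgZl_tmp; exact: (ev t.1.2 f).
  exact: (cvgB (ev (t.1.1 *: t.1.2 + t.2) f) (cvgD evZ (ev t.2 f))).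
rewrite (_ : dual_ball X = [set f | forall x, `|f x| <= `|x|]
  `&` \bigcap_(t in [set: K * X * X]) (h t @^-1` [set 0])).
  apply: compact_closedI; first exact: comp.
  apply: closed_bigI => t _.
  apply: preimage_closed; first by move=> f _; exact: hc.
  exact/accessible_closed_set1/hausdorff_accessible/norm_hausdorff.
apply/seteqP; split=> [f /dual_ballP[fl f1]|f [f1 fl]].
  by split=> // t _; rewrite /h /= fl subrr.
apply/dual_ballP; split=> // a x y.
by have /eqP := fl (a, x, y) I; rewrite /h /= subr_eq0 => /eqP.
Qed.

(** Taking real parts identifies [dual_ball X] with the real-linear forms below
    the norm: if [re (f x) <= `|x|] for all [x], rotating [f x] to its modulus
    gives [`|f x| <= `|x|]. The extreme point found over the reals is carried
    over by this identification. *)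
Lemma exists_extreme_norming z :
  exists2 e, extreme_points (dual_ball X) e & `|e z| = `|z|.
Proof.
pose N (x : realify S X) : R := re S `|x : X|.
have NE x : inj S (N x) = `|x : X| by rewrite inj_re// normr_real.
have Ns : sublinear N.
  split=> [x y|a x a0].
    by rewrite -(inj_le S) rmorphD/= !NE ler_normD.
  rewrite /N [a *: x]/(inj S a *: (x : X)) normrZ ger0_norm ?re_injM//.
  by rewrite -(rmorph0 (inj S)) inj_le.
have [u [[ul uN] uext] uz] := exists_extreme_dominated (z : realify S X) Ns.
have u0 : u 0 = 0 by have := ul (-1) 0 0; rewrite scaler0 addr0 scaleN1r addNr.
have [||e el eu] := @complexify _ _ S X u.
- by move=> x y; have := ul 1 x y; rewrite !scale1r.
- by move=> a x; have := ul a x 0; rewrite u0 !addr0.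
have ball_re f : dual_ball X f <->
    (linear f : Prop) /\ dominated N (fun x => re S (f x) : R^o).
  split=> [/dual_ballP[fl f1]|[fl [_ fN]]].
    split=> //; split=> [a x y|x].
      rewrite [a *: x]/(inj S a *: (x : X)) fl raddfD/=.
      by rewrite [inj S a *: f x]/(inj S a * f x) re_injM.
    by rewrite -(inj_le S) NE (le_trans (inj_re_le S _)).
  apply/dual_ballP; split=> // x; have [->|fx0] := eqVneq (f x) 0.
    by rewrite normr0.
  pose F := pack_linear fl.
  pose c := `|f x| / f x.
  have c1 : `|c| = 1 by rewrite normrM normfV normr_id divff ?normr_eq0.
  have fc : F (c *: x) = `|f x| by rewrite linearZ/= /GRing.scale/= divfK.
  have := fN (c *: x); rewrite -(inj_le S) NE normrZ c1 mul1r.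
  by rewrite [f _]fc inj_re// normr_real.
have eB : dual_ball X e.
  by apply/ball_re; split=> //; rewrite (funext eu).
exists e; last first.
  apply/eqP; rewrite eq_le ((dual_ballP _).1 eB).2/=.
  by rewrite -(NE z) -uz -eu inj_re_le.
split=> // f g t /[dup] fB /ball_re[fl fN] /[dup] gB /ball_re[gl gN] t0 t1 efg.
pose s := re S t; have ts : inj S s = t by rewrite inj_re// gtr0_real.
have [|||ef eg] := uext _ _ s fN gN.
- by rewrite -(inj_lt S) rmorph0 ts.
- by rewrite -(inj_lt S) rmorph1 ts.
- apply/funext => x; rewrite -eu efg.
  rewrite [LHS]/(re S (t * f x + (1 - t) * g x)).
  rewrite [RHS]/(s * re S (f x) + (1 - s) * re S (g x)).
  have -> : 1 - t = inj S (1 - s) by rewrite rmorphB rmorph1 ts.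
  by rewrite -{1}ts; exact: re_comb.
split; first by apply: (linear_re_inj (S := S) fl el) => x; rewrite eu -ef.
by apply: (linear_re_inj (S := S) gl el) => x; rewrite eu -eg.
Qed.

End DualBall.

(** * The weak topology *)

Section WeakTopology.
Context {K : numFieldType} {X : normedModType K}.
Implicit Types (f g : X -> K^o) (x y z : X).

Lemma weakly_open_slice f (c : K^o) (r : K) : dual X f ->
  weakly_open [set y | `|f y - c| < r].
Proof.
move=> fd; pose F : set_type (dual X) := SigSub (mem_set fd).
have fc : continuous ((fun h : {ptws set_type (dual X) -> K^o} => h F) \o
    (@dual_eval K X : initial_topology (@dual_eval K X) -> _)).
  move=> y; apply: continuous_comp; first exact: initial_continuous.
  exact: (@proj_continuous (set_type (dual X)) (fun=> K^o) F).
move/continuousP: fc => /(_ [set z | `|z - c| < r]); apply.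
rewrite (_ : [set z | _] = ball c r); first exact: ball_open.
by apply/seteqP; split=> z; rewrite -ball_normE /ball_ /= distrC.
Qed.

Lemma weakly_openI (U V : set X) :
  weakly_open U -> weakly_open V -> weakly_open (U `&` V).
Proof. exact: openI. Qed.

Lemma weakly_open_seq (I : eqType) (s : seq I) (U_ : I -> set X) :
  (forall i, weakly_open (U_ i)) ->
  weakly_open [set y | forall i, i \in s -> U_ i y].
Proof.
move=> Uo; elim: s => [|i s IHs].
  by rewrite (_ : [set y | _] = setT); [exact: openT|exact/seteqP].
rewrite (_ : [set y | _] = U_ i `&` [set y | forall j, j \in s -> U_ j y]).
  exact: weakly_openI.
apply/seteqP; split=> y /= H.
  split; first by apply: H; rewrite mem_head.
  by move=> j js; apply: H; rewrite inE js orbT.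
by move=> j; rewrite inE => /predU1P[->|]; case: H => // _; apply.
Qed.

End WeakTopology.

(** * Limit points of classes of extreme functionals *)

Section LimitPoints.
Context {R : realType} {K : numFieldType} (S : scalar_field R K).
Context {X : normedModType K}.
Implicit Types (x y : X).

Lemma sphere_scale_ge1 (f g : sphere_type X) (c : K) :
  sphere_val f = c *: sphere_val g -> 1 <= `|c|.
Proof.
move=> fcg.
have [_ f1] : dual_sphere X (sphere_val f) := set_valP f.
have [_] := supremum_neq0P f1 (oner_neq0 _); apply=> _ [y y1 <-].
rewrite fcg [X in `|X|]/(c * sphere_val g y) normrM ler_piMr//.
have /(dual_ballP S)[_ /(_ y)] := dual_sphere_ball (set_valP g).
by move=> /le_trans; apply.
Qed.

(** Proportional functionals of norm one have a proportionality factor of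
    modulus one. *)
Lemma sphere_equiv_norm (f g : sphere_type X) x :
  sphere_equiv f g -> `|sphere_val f x| = `|sphere_val g x|.
Proof.
move=> /asboolP[a [b [ab0 fg]]].
have [a0 b0] : a != 0 /\ b != 0.
  split; apply/eqP => c0; move: ab0 fg; rewrite c0 eqxx scale0r ?add0r ?addr0.
    by move=> [//|b0] /scaler_sphere_eq0/eqP; rewrite (negPf b0).
  by move=> [a0|//] /scaler_sphere_eq0/eqP; rewrite (negPf a0).
have fE : sphere_val f = (- (b / a)) *: sphere_val g.
  rewrite -[LHS](scalerK a0).
  rewrite (eqP (_ : a *: sphere_val f == - (b *: sphere_val g))).
    by rewrite scalerN scalerA scaleNr mulrC.
  by rewrite -addr_eq0 fg.
have gE : sphere_val g = (- (a / b)) *: sphere_val f.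
  by rewrite fE scalerA mulrNN mulrA divfK// divff// scale1r.
have c1 : `|- (b / a)| = 1.
  apply/eqP; rewrite eq_le (sphere_scale_ge1 fE) andbT.
  have := sphere_scale_ge1 gE; rewrite !normrN -(invf_div b) normfV.
  by rewrite invf_ge1// normr_gt0 mulf_neq0 ?invr_eq0.
by rewrite fE [X in `|X|]/(_ * sphere_val g x) normrM c1 mul1r.
Qed.

Lemma sphere_piP (s t : sphere_type X) :
  sphere_pi s = sphere_pi t <-> sphere_equiv s t.
Proof.
by split=> [/(@eqmodP _ (sphere_equiv_rel X))|H];
  last exact/(@eqmodP _ (sphere_equiv_rel X)).
Qed.

Lemma sphere_pi_repr (s : sphere_type X) :
  sphere_equiv s (repr (sphere_pi s) : sphere_type X).
Proof. by apply/sphere_piP; rewrite /sphere_pi reprK. Qed.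

Definition mk_sphere f (fS : dual_sphere X f) : sphere_type X :=
  SigSub (mem_set (fS : (dual_sphere X : set {ptws X -> K^o}) f)).

(** A neighbourhood witnessing that the class of [s] is not a limit point is
    pulled back to the sphere and extended to a pointwise open set. *)
Lemma limit_point_separation (s : sphere_type X) :
  ~ limit_point (pi_ext_dual_ball X) (sphere_pi s) ->
  \forall e \near (sphere_val s : {ptws X -> K^o}),
    extreme_points (dual_ball X) e -> forall eS : dual_sphere X e,
    sphere_equiv s (mk_sphere eS).
Proof.
move=> /existsNP[U /not_implyP[Us noU]].
have : nbhs s ((@sphere_pi K X) @^-1` U) by
  exact: (@pi_continuous (sphere_type X) {eq_quot sphere_equiv_rel X}%qT).
rewrite nbhsE => -[V [[N No NV] sV] VU].
rewrite -NV in sV VU.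
have : nbhs (sphere_val s : {ptws X -> K^o}) N by exact: open_nbhs_nbhs.
apply: filterS => e Ne ee eS; apply: contrapT => nse; apply: noU.
exists (sphere_pi (mk_sphere eS)); split.
- by apply/eqP => /esym/sphere_piP.
- by exists (mk_sphere eS).
- by apply: VU.
Qed.

(** The filter in the proof is generated by the sets of points [y] that are
    weakly close to [x] and almost at distance [2] from [x]; it is proper
    because [x] is diametral. Compactness of the dual ball turns the local
    statements around each functional [f] into one [y] such that no extreme
    functional [e] satisfies [`|e (x - y)| = `|x - y|]. *)
Theorem weak_DD2P_infinite : weak_DD2P X ->
  infinite_set (limit_point (pi_ext_dual_ball X)).
Proof.
move=> DD /finite_seqP[L LE].
pose val (c : sphere_quotient X) : X -> K^o :=
  sphere_val (repr c : sphere_type X).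
have vald c : dual X (val c).
  by have /dual_sphere_ball[] : dual_sphere X (val c) by exact: set_valP.
(* Keeping all representatives of limit points below 1 in modulus on W ensures
   that no functional of modulus 1 at x represents a limit point. *)
pose W := [set y | forall c, c \in L -> `|val c y - 0| < 1] `&` unit_ball X.
have Wo : relatively_weakly_open W.
  eexists; [|reflexivity]; apply: weakly_open_seq => c.
  exact: weakly_open_slice.
have W0 : W !=set0.
  exists 0; split; last by rewrite /unit_ball/= normr0.
  move=> c _; rewrite subr0 (_ : val c 0 = 0) ?normr0//.
  by have [fl _] := vald c; exact: (raddf0 (pack_linear fl)).
have [x [Wx x1] xDD] := DD W Wo W0.
have notlim (s : sphere_type X) : `|sphere_val s x| = 1 ->
    ~ limit_point (pi_ext_dual_ball X) (sphere_pi s).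
  move=> sx1 /=; rewrite LE /= => /Wx; rewrite subr0 /val.
  rewrite -(@sphere_equiv_norm s) ?sx1 ?ltxx//.
  exact: sphere_pi_repr.
pose D := [set Ue : set X * K |
  [/\ relatively_weakly_open Ue.1, Ue.1 x & 0 < Ue.2]].
pose B (Ue : set X * K) := [set y | Ue.1 y /\ 2 - Ue.2 < `|x - y|].
have FF : Filter (filter_from D B).
  apply: filter_from_filter.
    exists (unit_ball X, 1); split=> //=.
    by exists setT; [exact: openT|rewrite setTI].
  move=> [U a] [V b] [/= [U' U'o UE] Ux a0] [/= [V' V'o VE] Vx b0].
  have [c [c0 ca cb]] : exists c, [/\ 0 < c, c <= a & c <= b].
    by have [ab|ba] := real_leP (gtr0_real a0) (gtr0_real b0);
      [exists a|exists b; rewrite ltW].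
  exists (U `&` V, c); first split=> //.
    by exists (U' `&` V'); [exact: weakly_openI|rewrite UE VE setIACA setIid].
  move=> y [[/= Uy Vy] yc]; split; split=> //=.
    by apply: le_lt_trans yc; rewrite lerD2l lerN2.
  by apply: le_lt_trans yc; rewrite lerD2l lerN2.
have FP A : filter_from D B A -> A !=set0.
  move=> [[U e] [/= Uo Ux e0] BA].
  have [y [Uy ye]] : exists y, U y /\ 2 - e < `|x - y|.
    apply: contrapT => H.
    have := supremum_neq0P (xDD _ Uo Ux) _; rewrite pnatr_eq0 => /(_ isT)[_].
    move=> /(_ (2 - e)) H2.
    have : 2 <= 2 - e.
      apply: H2 => _ [y Uy <-]; rewrite real_leNgt ?normr_real//.
        by apply/negP => ye; apply: H; exists y.
      by rewrite realB ?gtr0_real.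
    by rewrite lerBrDr gerDl lt_geF.
  by exists y; apply: BA.
pose P y (e : {ptws X -> K^o}) :=
  extreme_points (dual_ball X) e -> `|e (x - y)| = `|x - y| -> False.
have [|y yP] := FP [set y | dual_ball X `<=` P y].
  apply: (compact_near_coveringP _).1 (compact_dual_ball S) _ _ _ FF _ => f fB.
  have /(dual_ballP S)[_ f1] := fB.
  have fd : dual X f by case: fB.
  have ev : continuous (fun h : {ptws X -> K^o} => h x).
    exact: (@proj_continuous X (fun=> K^o) x).
  have [fx1|fx1] := eqVneq `|f x| 1.
    have fS := dual_sphere_attained S fB x1 fx1.
    exists ([set e | extreme_points (dual_ball X) e ->
      forall eS : dual_sphere X e, sphere_equiv (mk_sphere fS) (mk_sphere eS)],
      [set y | [/\ `|f y - f x| < 1, unit_ball X y & 1 < `|x - y|]]).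
      split=> /=.
        exact: (limit_point_separation (notlim (mk_sphere fS) fx1)).
      exists ([set y | `|f y - f x| < 1] `&` unit_ball X, 1).
        split=> //=; last by split=> //=; rewrite subrr normr0.
        by eexists; [|reflexivity]; exact: weakly_open_slice.
      by move=> y [/= [fyx y1]]; rewrite -[2]/(1 + 1) addrK.
    move=> [e y] [/= eP [fyx y1 xy]] ee exy.
    (* Near f every extreme functional is proportional to f, whose value at
       x - y is small. *)
    have eS := dual_sphere_norming S ee.1 (lt_trans ltr01 xy) exy.
    have fxy : `|f (x - y)| = `|e (x - y)| :=
      sphere_equiv_norm (x - y) (eP ee eS).
    have [fl _] := fd; move: fyx; rewrite distrC.
    rewrite -[f x - f y](raddfB (pack_linear fl)) [X in X < _]fxy exy.
    by move=> /(lt_trans xy); rewrite ltxx.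
  have lt1 : `|f x| < 1 by rewrite lt_neqAle fx1 (le_trans (f1 x)).
  (* With this d, a norming e near f would give
     |x - y| <= |e x| + |e y| <= (|f x| + d) + 1 = 2 - d. *)
  pose d := (1 - `|f x|) / 2.
  have d0 : 0 < d by rewrite divr_gt0// subr_gt0.
  have dE : 1 - d = `|f x| + d by rewrite /d; field.
  exists ([set e : {ptws X -> K^o} | `|e x| < `|f x| + d],
      [set y | unit_ball X y /\ 2 - d < `|x - y|]).
    split=> /=.
      have := ev f (ball (f x) d) (nbhsx_ballx _ _ d0).
      apply: (@filterS _ _ (nbhs_filter (f : {ptws X -> K^o}))) => e.
      rewrite /= -ball_normE /ball_ /= distrC => efx.
      have := ler_normD (e x - f x) (f x); rewrite subrK => /le_lt_trans; apply.
      by rewrite addrC ltrD2l.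
    exists (unit_ball X, d) => //; split=> //=.
    by exists setT; [exact: openT|rewrite setTI].
  move=> [e y] [/= ex [y1 xy]] [/(dual_ballP S)[el eB] _] exy.
  move: xy; rewrite -exy [e _](raddfB (pack_linear el)) /= => xy.
  have := lt_le_trans xy (ler_normB (e x) (e y)).
  have e1 := le_trans (eB y) y1.
  move=> /lt_le_trans/(_ (lerD (ltW ex) e1)).
  by rewrite -dE (_ : 1 - d + 1 = 2 - d) ?ltxx//; ring.
have [e ee en] := exists_extreme_norming S (x - y).
by apply: (yP e _ ee en); case: ee.
Qed.

End LimitPoints.

(** * Real and complex scalars *)

Lemma closed_disc (K : numFieldType) (r : K) : r \is Num.real ->
  closed [set z : K^o | `|z| <= r].
Proof.
move=> rr; rewrite -openC openE => z /= /negP; rewrite -real_ltNge// => rz.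
apply/nbhs_ballP; exists (`|z| - r); first by rewrite /= subr_gt0.
move=> w; rewrite -ball_normE /ball_ /= => zw wr.
have : `|z| - r <= `|z - w|.
  by apply: le_trans (lerB_dist z w); rewrite lerD2l lerN2.
by move=> /(lt_le_trans zw); rewrite ltxx.
Qed.

Section RealScalars.
Context {R : realType}.

Lemma real_compact_disc (r : R) : compact [set z : R^o | `|z| <= r].
Proof.
rewrite (_ : [set z | _] = `[- r, r]%classic); first exact: segment_compact.
by apply/seteqP; split=> z /=; rewrite in_itv/= ler_norml.
Qed.

Lemma real_complexify (V : lmodType R) (u : V -> R) :
  (forall x y, u (x + y) = u x + u y) ->
  (forall a x, u (a *: x) = a * u x) ->
  exists2 f : V -> R^o, (linear f : Prop) & forall x, f x = u x.
Proof. by move=> uD uZ; exists u => // a x y; rewrite uD uZ. Qed.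

Definition real_scalars : scalar_field R R :=
  @ScalarField R R idfun idfun (fun _ _ => erefl) erefl (fun _ _ => erefl)
    (fun _ _ => erefl) (fun x => ler_norm x) real_compact_disc real_complexify.

End RealScalars.

Section ComplexScalars.
Local Open Scope complex_scope.
Local Notation Re := complex.Re.
Local Notation Im := complex.Im.
Context {R : realType}.

Lemma Re_zmod_morphism : {morph (@Re R) : x y / x - y}.
Proof. by case=> a b [c d]. Qed.

HB.instance Definition _ := GRing.isZmodMorphism.Build R[i] R (@Re R)
  Re_zmod_morphism.

Lemma Re_realM (a : R) (z : R[i]) : Re (a%:C * z) = a * Re z.
Proof. by case: z => b c /=; rewrite mul0r subr0. Qed.

Lemma Re_le_norm (z : R[i]) : (Re z)%:C <= `|z|.
Proof.
by apply: le_trans (normc_ge_Re z); rewrite lecR ler_norm.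
Qed.

Lemma Im_le_norm (z : R[i]) : `|Im z|%:C <= `|z|.
Proof. by have := normc_ge_Re (z * 'i); rewrite ReiNIm normrN normrM
  (normc_def 'i) /= expr0n expr1n add0r sqrtr1 mulr1. Qed.

Lemma norm_Complex_le (a b : R) : `|a +i* b| <= (`|a| + `|b|)%:C.
Proof.
rewrite normc_def lecR/= -[leRHS]ger0_norm ?addr_ge0// -sqrtr_sqr.
rewrite ler_sqrt ?sqr_ge0// sqrrD !real_normK ?num_real// addrAC lerDl.
by rewrite mulrn_wge0// mulr_ge0.
Qed.

Lemma continuous_Complex :
  continuous (fun p : R^o * R^o => (p.1 +i* p.2) : R[i]^o).
Proof.
move=> p; apply/cvgrPdist_lt => e e0.
have eE : e = (Re e)%:C by rewrite RRe_real// gtr0_real.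
have e20 : 0 < Re e / 2 by rewrite divr_gt0// -ltcR -eE.
near=> q.
have q1 : `|p.1 - q.1| < Re e / 2.
  by near: q; apply: cvgr_dist_lt => //; exact: cvg_fst.
have q2 : `|p.2 - q.2| < Re e / 2.
  by near: q; apply: cvgr_dist_lt => //; exact: cvg_snd.
apply: le_lt_trans (norm_Complex_le _ _) _.
by rewrite [ltRHS]eE ltcR (splitr (Re e)) ltrD.
Unshelve. all: by end_near. Qed.

(** The disc is a closed part of the image of a square. *)
Lemma complex_compact_disc (r : R[i]) : compact [set z : R[i]^o | `|z| <= r].
Proof.
have [r0|r0] := boolP (0 <= r); last first.
  rewrite (_ : [set z | _] = set0); first exact: compact0.
  apply/seteqP; split=> z //= zr; move: r0.
  by rewrite (le_trans _ zr).
pose s := Re r; have rs : r = s%:C by rewrite RRe_real// ger0_real.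
pose Q := ([set` `[- s, s]] `*` [set` `[- s, s]] : set (R^o * R^o)).
have cQ : compact ((fun p : R^o * R^o => (p.1 +i* p.2) : R[i]^o) @` Q).
  apply: continuous_compact.
    by apply: continuous_subspaceT; exact: continuous_Complex.
  by apply: compact_setX; exact: segment_compact.
rewrite (_ : [set z | _] = ((fun p : R^o * R^o => (p.1 +i* p.2) : R[i]^o) @` Q)
   `&` [set z | `|z| <= r]).
  by apply: compact_closedI => //; apply/closed_disc/ger0_real.
apply/seteqP; split=> z /=; last by case.
move=> zr; split=> //; exists (Re z, Im z); last by case: z {zr}.
by split; rewrite /= in_itv/= -ler_norml -lecR -rs (le_trans _ zr)//
  ?normc_ge_Re ?Im_le_norm.
Qed.

Lemma complex_complexify (V : lmodType R[i]) (u : V -> R) :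
  (forall x y, u (x + y) = u x + u y) ->
  (forall (a : R) x, u (a%:C *: x) = a * u x) ->
  exists2 f : V -> R[i]^o, (linear f : Prop) & forall x, Re (f x) = u x.
Proof.
move=> uD uZ; exists (fun x => u x -i* u ('i *: x)) => // c x y.
have uN z : u (- z) = - u z.
  by have := uZ (-1) z; rewrite rmorphN1 scaleN1r mulN1r.
have uc w : u (c *: w) = Re c * u w + Im c * u ('i *: w).
  by rewrite -!uZ -uD scalerA -scalerDl {1}(complexE c) [_ * 'i]mulrC.
have ui : u ('i *: (c *: x)) = Re c * u ('i *: x) - Im c * u x.
  rewrite scalerA mulrC -scalerA uc scalerA -expr2 sqr_i scaleN1r uN.
  by rewrite mulrN.
rewrite scalerDr !uD uc ui.
rewrite [RHS]/(c * (u x -i* u ('i *: x)) + (u y -i* u ('i *: y))).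
case: c {uc ui} => a b.
by apply/eqP; rewrite eq_complex /=; apply/andP; split; apply/eqP; ring.
Qed.

Definition complex_scalars : scalar_field R R[i] :=
  @ScalarField R R[i] (real_complex R) (@Re R) Re_realM erefl (@lecR R)
    (fun z => @RRe_real R z) Re_le_norm complex_compact_disc complex_complexify.

End ComplexScalars.

Theorem proposition2p5 (R : realType) :
  (forall X : completeNormedModType R,
     weak_DD2P X -> infinite_set (limit_point (pi_ext_dual_ball X))) /\
  (forall X : completeNormedModType R[i],
     weak_DD2P X -> infinite_set (limit_point (pi_ext_dual_ball X))).
Proof.
split=> X.
  exact: (weak_DD2P_infinite real_scalars).
exact: (weak_DD2P_infinite complex_scalars).
Qed.
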